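(* Let $k>1$. If $G$ is a tree (or forest) and there exists a $k$-dominating independent set in $G$, then it is unique. That is, $\mathrm{mi}_k(n,\mathcal{T})=1$.
   Context: All graphs are simple. For a positive integer $k$, a $k$-dominating independent set ($k$-DIS) of a graph $G$ is a set $D\subseteq V(G)$ that induces no edge and such that every vertex $v\in V(G)\setminus D$ satisfies $|N(v)\cap D|\geq k$, where $N(v)$ is the set of neighbors of $v$. $\mathcal{T}$ denotes the family of trees, and $\mathrm{mi}_k(n,\mathcal{T})$ denotes the maximum number of $k$-DISes in the $n$-vertex members of $\mathcal{T}$.
   Formalization: The equality mi_k(n,T)=1 fails for 2≤n≤k (no n-vertex tree has a k-DIS, so the value is 0; e.g. k=n=2); it is proved for every n for which some n-vertex tree has a k-DIS, and outright for every n>k. *)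

(* Defs.v *)
From mathcomp Require Import all_boot.
From mathcomp Require Import boolp.

Set Implicit Arguments.
Unset Strict Implicit.
Unset Printing Implicit Defensive.

(* A finite simple graph is given by its adjacency relation on a finType. *)
Definition is_simple (V : finType) (e : rel V) : Prop :=
  symmetric e /\ irreflexive e.

Definition nbhd (V : finType) (e : rel V) (v : V) : {set V} := [set u | e v u].

Definition kDIS (V : finType) (e : rel V) (k : nat) (D : {set V}) : bool :=
  [forall x in D, forall y in D, ~~ e x y] &&
  [forall v in ~: D, k <= #|nbhd e v :&: D|].

(* [ucycle e c] also holds for the empty sequence and, in a simple graph, for
   both orientations of a single edge; genuine graph cycles have length at
   least 3. *)
Definition is_forest (V : finType) (e : rel V) : Prop :=
  is_simple e /\ forall c : seq V, 2 < size c -> ~ ucycle e c.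

(* The graph with no vertex is a forest but not a tree. *)
Definition is_tree (V : finType) (e : rel V) : Prop :=
  [/\ is_forest e, 0 < #|V| & forall x y : V, connect e x y].

Definition rel_of_set (V : finType) (A : {set V * V}) : rel V :=
  fun x y => (x, y) \in A.

(* Every n-vertex graph is isomorphic to one on 'I_n, and relations on 'I_n are
   encoded by the sets of pairs so that they range over a finType.  The maximum
   over an empty family is 0. *)
Definition mi (k n : nat) (F : forall V : finType, rel V -> Prop) : nat :=
  \max_(A : {set 'I_n * 'I_n} | `[< F 'I_n (rel_of_set A) >])
    #|[set D : {set 'I_n} | kDIS (rel_of_set A) k D]|.

(* Main.v *)
Require Import Defs.
From mathcomp Require Import all_boot.
From mathcomp Require Import boolp.

(** Let [D] and [D'] be two [k]-dominating independent sets of a forest, with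
    [k >= 2].  A vertex [v] of [D] outside [D'] has at least two neighbours in
    [D'], and none of them is in [D] because [D] is independent; so these
    neighbours lie again in the symmetric difference of [D] and [D'].  Hence
    that difference induces a subgraph of minimum degree at least two
    ([kDIS_symdiff_degree]).  A finite graph of minimum degree two contains a
    cycle unless it has no vertex ([min_degree2_has_cycle]), so in a forest the
    difference is empty and [D = D'] ([kDIS_forest_unique]).

    It follows that every [n]-vertex tree has at most one such set, so
    [mi k n is_tree] is [1] as soon as one [n]-vertex tree has one
    ([mi_tree_eq1]).  For [n > k] the star is such a tree: its leaves are
    independent and its centre has [n - 1 >= k] neighbours among them. *)

(** Extending a path backwards at its first vertex [x], through a neighbour [y]
    other than the second vertex, either lengthens the path or meets it at its
    third vertex or later, which closes a cycle of length at least three.  As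
    uniq paths have bounded length, the second case must occur. *)
Lemma min_degree2_has_cycle {V : finType} {e : rel V} {S : {set V}} :
  is_simple e -> S != set0 -> {in S, forall x, 1 < #|nbhd e x :&: S|} ->
  exists2 c : seq V, 2 < size c & ucycle e c.
Proof.
move=> [e_sym e_irr] /set0Pn [x0 Sx0] deg.
have grow n : (exists2 c, 2 < size c & ucycle e c) \/
    exists x p, [/\ size p = n, x \in S, path e x p & uniq (x :: p)].
  elim: n => [|n [|[x [p [sz_p Sx e_p uniq_p]]]]]; [|by left|].
    by right; exists x0, [::].
  (* For an empty [p] the avoided vertex is [x], which is no neighbour of [x]. *)
  have [y]: exists y, y \in (nbhd e x :&: S) :\ head x p.
    apply/set0Pn; rewrite -card_gt0.
    by move: (deg x Sx); rewrite (cardsD1 (head x p)); case: (head x p \in _) => [|/ltnW].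
  rewrite !inE => /and3P [y_nhead exy Sy].
  have [y_in|y_out] := boolP (y \in x :: p); last first.
    by right; exists y, (x :: p); split; rewrite /= ?sz_p ?y_out // e_sym exy.
  left; move: y_in; rewrite inE => /predU1P [yx|y_in].
    by rewrite yx e_irr in exy.
  case/splitPr: y_in y_nhead e_p uniq_p {sz_p} => p1 p2 y_nhead.
  rewrite -cat_rcons cat_path => /andP [e_p _].
  rewrite -cat_cons cat_uniq => /andP [uniq_p _].
  exists (x :: rcons p1 y); last first.
    by rewrite /ucycle /cycle rcons_path e_p last_rcons e_sym exy.
  by case: p1 y_nhead {e_p uniq_p} => [|z p1]; rewrite /= ?eqxx ?size_rcons.
have [//|[x [p [sz_p _ _ uniq_p]]]] := grow #|V|.
by have := max_card (mem (x :: p)); rewrite (card_uniqP uniq_p) /= sz_p ltnn.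
Qed.

Lemma kDISP {V : finType} {e : rel V} {k : nat} {D : {set V}} :
  reflect ({in D &, forall x y, ~~ e x y} /\
           forall v, v \notin D -> k <= #|nbhd e v :&: D|)
          (kDIS e k D).
Proof.
apply: (iffP andP) => [[indep dom]|[indep dom]]; split.
- move=> x y Dx Dy.
  by move/forall_inP: indep => /(_ x Dx) /forall_inP /(_ y Dy).
- by move=> v Dv; move/forall_inP: dom => /(_ v); rewrite inE; apply.
- by apply/forall_inP => x Dx; apply/forall_inP => y Dy; apply: indep.
- by apply/forall_inP => v; rewrite inE; apply: dom.
Qed.

(** The neighbours that dominate a vertex of [D] outside [D'] belong to [D'],
    and independence of [D] keeps them out of [D]. *)
Lemma kDIS_setD_degree {V : finType} {e : rel V} {k : nat} {D D' : {set V}} :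
  kDIS e k D -> kDIS e k D' ->
  {in D :\: D', forall x, k <= #|nbhd e x :&: (D' :\: D)|}.
Proof.
move=> /kDISP [indep _] /kDISP [_ dom'] x /setDP [Dx D'x].
apply: leq_trans (dom' x D'x) _; apply/subset_leq_card/subsetP => y.
rewrite !inE => /andP [exy D'y]; rewrite exy D'y andbT /=.
by apply: contraL exy => Dy; apply: indep.
Qed.

Lemma kDIS_symdiff_degree {V : finType} {e : rel V} {k : nat} {D D' : {set V}} :
  kDIS e k D -> kDIS e k D' ->
  {in (D :\: D') :|: (D' :\: D),
    forall x, k <= #|nbhd e x :&: ((D :\: D') :|: (D' :\: D))|}.
Proof.
move=> kD kD' x /setUP [] xD.
  apply: leq_trans (kDIS_setD_degree kD kD' _ xD) _.
  by apply/subset_leq_card/setIS/subsetUr.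
apply: leq_trans (kDIS_setD_degree kD' kD _ xD) _.
by apply/subset_leq_card/setIS/subsetUl.
Qed.

Lemma kDIS_forest_unique {V : finType} {e : rel V} {k : nat} {D D' : {set V}} :
  1 < k -> is_forest e -> kDIS e k D -> kDIS e k D' -> D = D'.
Proof.
move=> k_gt1 [e_simple acyclic] kD kD'.
have [|S_n0] := eqVneq ((D :\: D') :|: (D' :\: D)) set0.
  move/eqP; rewrite setU_eq0 !setD_eq0 => sDD'.
  by apply/eqP; rewrite eqEsubset.
have deg x xS := leq_trans k_gt1 (kDIS_symdiff_degree kD kD' x xS).
have [c c_gt2 e_c] := min_degree2_has_cycle e_simple S_n0 deg.
by case: (acyclic c c_gt2).
Qed.

Lemma kDIS_preimset {V W : finType} {e : rel V} {e' : rel W} {f : W -> V}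
    {k : nat} {D : {set V}} :
  bijective f -> (forall x y, e' x y = e (f x) (f y)) ->
  kDIS e k D -> kDIS e' k (f @^-1: D).
Proof.
move=> bij_f e'E /kDISP [indep dom]; apply/kDISP; split.
  by move=> x y; rewrite !inE e'E; apply: indep.
move=> v; rewrite inE => /dom.
rewrite -(on_card_preimset (onW_bij _ bij_f)).
by congr (_ <= #|pred_of_set _|); apply/setP => y; rewrite !inE e'E.
Qed.

Lemma is_tree_preim {V W : finType} {e : rel V} {e' : rel W} {f : W -> V} :
  bijective f -> (forall x y, e' x y = e (f x) (f y)) ->
  is_tree e -> is_tree e'.
Proof.
move=> bij_f e'E [[[e_sym e_irr] acyclic] V_gt0 conn].
split; [split; [split|]| |].
- by move=> x y; rewrite !e'E e_sym.
- by move=> x; rewrite e'E e_irr.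
- move=> c c_gt2 /andP [e'_c uniq_c]; apply: (acyclic (map f c)).
    by rewrite size_map.
  rewrite /ucycle (map_inj_uniq (bij_inj bij_f)) uniq_c andbT.
  by apply: homo_cycle e'_c => x y; rewrite e'E.
- by rewrite (bij_eq_card bij_f).
case: bij_f => g fK gK x y; rewrite -[x]fK -[y]fK.
have /connectP [p] := conn (f x) (f y).
elim: p (f x) => [|z p IHp] u /= => [_ ->|/andP [euz e_p] y_last]; first exact: connect0.
by apply: connect_trans (IHp z e_p y_last); apply: connect1; rewrite e'E !gK.
Qed.

Lemma mi_tree_eq1 {k : nat} {V : finType} {e : rel V} {D : {set V}} :
  1 < k -> is_tree e -> kDIS e k D -> mi k #|V| is_tree = 1.
Proof.
move=> k_gt1 e_tree kD; apply/eqP; rewrite eqn_leq; apply/andP; split.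
  apply/bigmax_leqP => A /asboolP [A_forest _ _].
  apply/card_le1P => D1; rewrite inE => kD1 D2; rewrite !inE.
  apply/idP/eqP => [kD2|-> //].
  exact: kDIS_forest_unique k_gt1 A_forest kD2 kD1.
pose f : 'I_#|V| -> V := enum_val.
pose A := [set p : 'I_#|V| * 'I_#|V| | e (f p.1) (f p.2)].
have AE x y : rel_of_set A x y = e (f x) (f y) by rewrite /rel_of_set inE.
have bij_f : bijective f by exact: enum_val_bij.
apply: leq_trans (leq_bigmax_cond A _); last first.
  by apply/asboolP; apply: is_tree_preim bij_f AE e_tree.
by apply/card_gt0P; exists (f @^-1: D); rewrite inE; apply: kDIS_preimset kD.
Qed.

Definition star {V : finType} (c : V) : rel V :=
  fun x y => (x == c) (+) (y == c).

(** Along a cycle of length at least three the centre would have to occur at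
    every second place, hence twice, or else two leaves would be adjacent. *)
Lemma star_is_tree {V : finType} (c : V) : is_tree (star c).
Proof.
have star_sym : symmetric (star c) by move=> x y; rewrite /star addbC.
split; [split; [split|]| |].
- exact: star_sym.
- by move=> x; rewrite /star addbb.
- case=> [|x [|y [|z s]]] //= _; rewrite /ucycle /= /star.
  rewrite !inE !negb_or; case: (eqVneq x c) => [->|x_leaf] /=.
    by case: (eqVneq y c) => //= _; case: (eqVneq z c) => //= _; rewrite !andbF.
  case: (eqVneq y c) => [->|] //=; case: (eqVneq z c) => //= z_leaf.
  case: s => [|t s] /=; rewrite (negPf z_leaf) /=; first by rewrite (negPf x_leaf).
  by rewrite !inE; case: (eqVneq t c) => //= _; rewrite !andbF.
- by apply/card_gt0P; exists c.
have to_c x : connect (star c) x c.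
  have [->|x_leaf] := eqVneq x c; first exact: connect0.
  by apply: connect1; rewrite /star eqxx (negPf x_leaf).
by move=> x y; apply: connect_trans (to_c x) _; rewrite (sym_connect_sym star_sym).
Qed.

Lemma star_leaves_kDIS {V : finType} (c : V) {k : nat} :
  k < #|V| -> kDIS (star c) k [set~ c].
Proof.
move=> k_lt; apply/kDISP; split.
  by move=> x y; rewrite !inE /star => /negPf -> /negPf ->.
move=> v; rewrite !inE negbK => /eqP ->.
suff ->: nbhd (star c) c :&: [set~ c] = [set~ c].
  by rewrite cardsC1 -ltnS (ltn_predK k_lt).
by apply/setP => x; rewrite !inE /star eqxx andbb.
Qed.

Theorem theorem3p6 (k : nat) (hk : 1 < k) :
  [/\ (forall (V : finType) (e : rel V), is_forest e ->
        (exists D : {set V}, kDIS e k D) -> exists! D : {set V}, kDIS e k D),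
      (forall n : nat,
        (exists (V : finType) (e : rel V),
          [/\ #|V| = n, is_tree e & exists D : {set V}, kDIS e k D]) ->
        mi k n is_tree = 1)
    & (forall n : nat, k < n -> mi k n is_tree = 1)].
Proof.
split.
- move=> V e e_forest [D kD]; exists D; split=> // D' kD'.
  exact: kDIS_forest_unique hk e_forest kD kD'.
- by move=> n [V [e [<- e_tree [D kD]]]]; apply: mi_tree_eq1 hk e_tree kD.
case=> // m k_lt; rewrite -[m.+1]card_ord in k_lt *.
exact: mi_tree_eq1 hk (star_is_tree ord0) (star_leaves_kDIS ord0 k_lt).
Qed.
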